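(* There is a constant $c>0$ such that if $m\ge cn$, then there is a family of $n$ permutations of $[m]$ which constitute an oblivious $MC(n,m)$ algorithm.
   Context: Musical Chairs game $MC(n,m)$: $n$ players each assigned a finite word over $[m]=\{1,\dots,m\}$ (here a permutation of $[m]$, i.e. a word of length $m$ containing each letter once) that it traverses cyclically; the adversarial scheduler chooses each player's starting position; a player is in conflict if another player occupies the same chair; in each round, while a conflict exists, the scheduler selects a nonempty set of players currently in conflict and each moves to the next letter of its word (cyclically). A collection of $n$ words is an oblivious $MC(n,m)$ algorithm if for every choice of starting positions and every scheduler strategy, after finitely many rounds no two players occupy the same chair. *)

(* Defs.v *)
From mathcomp Require Import all_boot.

Set Implicit Arguments.
Unset Strict Implicit.
Unset Printing Implicit Defensive.

(* The players are 'I_n and the chairs are 'I_m. A word is a sequence of      *)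
(* chairs; a player's place on its word u is an index in 'I_(size u), and     *)
(* ordS is the cyclic successor of indices.                                   *)

Definition is_perm_word (m : nat) (u : seq 'I_m) : Prop :=
  size u = m /\ forall a : 'I_m, count_mem a u = 1%N.

Definition config (n m : nat) (w : 'I_n -> seq 'I_m) : Type :=
  {dffun forall i : 'I_n, 'I_(size (w i))}.

Definition chair (n m : nat) (w : 'I_n -> seq 'I_m) (c : config w) (i : 'I_n)
    : 'I_m :=
  tnth (in_tuple (w i)) (c i).

Definition in_conflict (n m : nat) (w : 'I_n -> seq 'I_m) (c : config w)
    : {set 'I_n} :=
  [set i | [exists j, (j != i) && (chair c j == chair c i)]].

Definition move (n m : nat) (w : 'I_n -> seq 'I_m) (c : config w)
    (S : {set 'I_n}) : config w :=
  [ffun i => if i \in S then ordS (c i) else c i].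

(* A strategy may depend on the whole history of the play: it is given the    *)
(* current configuration and the list of all earlier ones, latest first.      *)
Definition strategy (n m : nat) (w : 'I_n -> seq 'I_m) : Type :=
  config w -> seq (config w) -> {set 'I_n}.

Definition legal (n m : nat) (w : 'I_n -> seq 'I_m) (sigma : strategy w)
    : Prop :=
  forall (c : config w) (past : seq (config w)),
    in_conflict c != set0 ->
    sigma c past != set0 /\ sigma c past \subset in_conflict c.

(* The current configuration and the earlier ones after t rounds. Once there  *)
(* is no conflict the game is over and the configuration no longer changes.   *)
Fixpoint play (n m : nat) (w : 'I_n -> seq 'I_m) (sigma : strategy w)
    (start : config w) (t : nat) : config w * seq (config w) :=
  match t with
  | 0 => (start, [::])
  | t'.+1 =>
      let: (c, past) := play sigma start t' in
      if in_conflict c == set0 then (c, past)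
      else (move c (sigma c past), c :: past)
  end.

(* Words must be nonempty: a player with an empty word has no starting        *)
(* position, and the condition on plays would hold vacuously.                 *)
Definition oblivious_MC_algorithm (n m : nat) (w : 'I_n -> seq 'I_m) : Prop :=
  (forall i : 'I_n, w i <> [::]) /\
  forall (start : config w) (sigma : strategy w), legal sigma ->
    exists t : nat, injective (chair (play sigma start t).1).

(* Main.v *)
Require Import Defs.
From HB Require Import structures.
From mathcomp Require Import all_boot all_order all_algebra.
From mathcomp Require Import reals.
From mathcomp Require Import all_fingroup zify.
From mathcomp Require boolp.

(* Random permutations work. Cut an endless play into windows containing       *)
(* between 5n and 7n moves. A player leaves a chair only if somebody else is   *)
(* on it, and that other player either leaves the same chair later in the      *)
(* window or sits there at its end. Hence the T departures of a window use at  *)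
(* most (T + n) / 2 chairs: there are at least 2n coincidences, each of which  *)
(* has probability about 1/m for each of the at most 7n candidate partners.    *)
(* A union bound over the m^n starting positions and the numbers of moves in   *)
(* about log m consecutive windows then excludes the play for m >= 2^24 n. The *)
(* only obstacle is that a player making more than m/2 moves ("heavy") shows   *)
(* the same letters again, which gives no new coincidences. There are only     *)
(* O(n (log m) / m) heavy players, so few that a union bound over them and a   *)
(* single window shows that they have fewer than n coincidences among          *)
(* themselves; at least n coincidences per window thus involve a fresh letter  *)
(* of a light player.                                                          *)

(** Probabilities are replaced by counts of families of permutations. Coincidences are recorded as
    links from a letter to a partner of strictly lower rank. Switching ([card_respects]) shows that
    k given links hold in at most a fraction (2/m)^k of the families if no player has more than m/2
    linked letters. Summing over the choices of d links in each of W windows of at most N letters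
    gives the fraction (2^N (2N/m)^d)^W of [card_repeated_windows]. Union bounds then make both
    [long_bad] and [short_bad] rare, so [good_family_exists] avoids them, whereas by [run_is_bad] an
    endless play puts its family into one of them. *)

Set Implicit Arguments.
Unset Strict Implicit.
Unset Printing Implicit Defensive.

(** * Counting families of permutations with many coincidences *)

Section Counting.
Variables n m : nat.

Notation letter := ('I_n * 'I_m)%type.
Implicit Type H : {set 'I_n}.
Notation perms := {ffun 'I_n -> {perm 'I_m}}.

Definition seat (pi : perms) (l : letter) : 'I_m := pi l.1 l.2.

(* A coincidence is charged to its letter of higher rank. The heavy players,  *)
(* who form H, share the lowest rank, so they are never charged.              *)
Definition rk (H : {set 'I_n}) (j : 'I_n) : nat := if j \in H then 0 else j.+1.

Definition repeated (pi : perms) (H : {set 'I_n}) (A : {set letter}) : {set letter} :=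
  [set l in A | [exists l' in A, (rk H l'.1 < rk H l.1) && (seat pi l' == seat pi l)]].

Lemma rk_gt0 (H : {set 'I_n}) j : (0 < rk H j) = (j \notin H).
Proof. by rewrite /rk; case: (j \in H). Qed.

Lemma rk_inj (H : {set 'I_n}) i j : i \notin H -> rk H i = rk H j -> i = j.
Proof.
rewrite /rk => /negbTE ->; case: (j \in H) => // [[/val_inj]] //.
Qed.

(** Light letters that are not repeated lie on distinct chairs: a common chair forces equal ranks,
    hence one player, whose word is injective. They also avoid the chairs of the heavy letters. *)
Lemma card_repeated pi H (A : {set letter}) :
  #|[set l in A | l.1 \notin H]| + #|seat pi @: [set l in A | l.1 \in H]| <=
  #|seat pi @: A| + #|repeated pi H A|.
Proof.
set B := [set l in A | l.1 \notin H]; set A0 := [set l in A | l.1 \in H].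
have repB : repeated pi H A \subset B.
  apply/subsetP => l; rewrite !inE => /andP[-> /existsP[l' /and3P[_ + _]]] /=.
  by move=> h; rewrite -rk_gt0 (leq_ltn_trans _ h).
have -> : #|B| = #|B :\: repeated pi H A| + #|repeated pi H A|.
  by rewrite cardsD (setIidPr repB) subnK // subset_leq_card.
rewrite addnAC leq_add2r.
have injD : {in B :\: repeated pi H A &, injective (seat pi)}.
  have aux l l' : l \in B :\: repeated pi H A -> l' \in B -> seat pi l' = seat pi l ->
      rk H l.1 <= rk H l'.1.
    rewrite !inE => /andP[/negP lN /andP[lA lH]] /andP[l'A _] e.
    rewrite leqNgt; apply/negP => lt; apply: lN; rewrite lA /=.
    by apply/existsP; exists l'; rewrite l'A lt e eqxx.
  move=> l l' lD l'D e.
  have lB : l \in B by move: lD; rewrite inE => /andP[].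
  have l'B : l' \in B by move: l'D; rewrite inE => /andP[].
  have er : rk H l.1 = rk H l'.1 by apply/eqP; rewrite eqn_leq !aux.
  have e1 : l.1 = l'.1.
    by apply: rk_inj er; move: lB; rewrite inE => /andP[].
  move: e; rewrite /seat e1 => /perm_inj e2.
  by rewrite [l]surjective_pairing e1 e2 -surjective_pairing.
rewrite -(card_in_imset injD) -cardsUI.
have -> : seat pi @: (B :\: repeated pi H A) :&: seat pi @: A0 = set0.
  apply/setP => a; rewrite in_set0; apply/negP => /setIP[/imsetP[l lD ->]].
  move=> /imsetP[l' l'0 e]; move: lD l'0; rewrite !inE.
  move=> /andP[/negP lN /andP[lA lH]] /andP[l'A l'H]; apply: lN.
  rewrite lA; apply/existsP; exists l'; rewrite l'A e eqxx andbT.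
  by rewrite /rk l'H (negbTE lH).
rewrite cards0 addn0; apply/subset_leq_card/subUsetP; split; apply: imsetS.
  by apply/subsetP => l; rewrite !inE => /andP[_ /andP[]].
by apply/subsetP => l; rewrite !inE => /andP[].
Qed.

Notation links := {ffun letter -> option letter}.
Implicit Types (g : links) (pi : perms).

Definition linked (g : links) : {set letter} := [set l | g l != None].

Definition respects (g : links) (pi : perms) : bool :=
  [forall l, if g l is Some l' then seat pi l == seat pi l' else true].

Lemma respectsP g pi :
  reflect (forall l l', g l = Some l' -> seat pi l = seat pi l') (respects g pi).
Proof.
apply: (iffP forallP) => [h l l' e|h l].
  by move/(_ l): h; rewrite e => /eqP.
by case e: (g l) => [l'|//]; apply/eqP/h.
Qed.

Definition descending H (g : links) :=
  forall l l', g l = Some l' -> rk H l'.1 < rk H l.1.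

Definition switch (l : letter) (x : perms * 'I_m) : perms :=
  [ffun j => if j == l.1 then (tperm l.2 x.2 * x.1 j)%g else x.1 j].

Lemma seat_switch_other l x l' : l'.1 != l.1 -> seat (switch l x) l' = seat x.1 l'.
Proof. by move=> h; rewrite /seat ffunE (negbTE h). Qed.

Lemma seat_switch_same l x p :
  seat (switch l x) (l.1, p) = seat x.1 (l.1, tperm l.2 x.2 p).
Proof. by rewrite /seat ffunE eqxx /= permM. Qed.

(* Switching: at a linked letter l of maximal rank, composing its permutation *)
(* with a transposition of l.2 and any unlinked position keeps all the other  *)
(* links, and the result determines the position since the seat of the        *)
(* partner of l is unchanged.                                                 *)
Lemma card_respects H k (g : links) :
  #|linked g| = k -> descending H g ->
  (forall j, #|[set l in linked g | l.1 == j]|.*2 <= m) ->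
  #|[set pi | respects g pi]| * m ^ k <= m`! ^ n * 2 ^ k.
Proof.
elim: k g => [|k IH] g gk gd gh.
  rewrite !expn0 !muln1; apply: leq_trans (max_card _) _.
  by rewrite card_ffun card_ord card_Sn.
have [l0 l0g] : exists l, l \in linked g by apply/set0Pn; rewrite -card_gt0 gk.
have [l lg lmax] := @arg_maxnP _ l0 (mem (linked g)) (fun l => rk H l.1) l0g.
rewrite -[mem _ l]/(l \in linked g) in lg.
pose g' : links := [ffun l1 => if l1 == l then None else g l1].
have lk' : linked g' = linked g :\ l.
  by apply/setP => l1; rewrite !inE ffunE; have [] := eqVneq l1 l.
have g'k : #|linked g'| = k.
  by rewrite lk'; have := cardsD1 l (linked g); rewrite lg gk; lia.
have g'g l1 l2 : g' l1 = Some l2 -> l1 != l /\ g l1 = Some l2.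
  by rewrite ffunE; case: eqP.
have := IH g' g'k (fun l1 l2 e => gd l1 l2 (g'g l1 l2 e).2).
have sub : linked g' \subset linked g by rewrite lk' subsetDl.
have sub' j : [set l in linked g' | l.1 == j] \subset [set l in linked g | l.1 == j].
  by apply/subsetP => l1; rewrite inE => /andP[/(subsetP sub) a b]; rewrite inE a b.
have gh' j : #|[set l in linked g' | l.1 == j]|.*2 <= m.
  by apply: leq_trans (gh j); rewrite leq_double subset_leq_card.
move=> /(_ gh') {}IH.
(* At least half of the positions of player [l.1] are free, since at most m/2 are linked; this costs
   the factor 2 per link. *)
pose F := [set p | (l.1, p) \notin linked g'].
have Fm : m <= #|F|.*2.
  have := cardsC F; rewrite card_ord.
  have : #|~: F| <= #|[set l1 in linked g' | l1.1 == l.1]|.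
    rewrite -(card_imset (mem (~: F)) (f := fun p => (l.1, p))); last by move=> p q [].
    apply/subset_leq_card/subsetP => l1 /imsetP[p pF ->]; move: pF.
    by rewrite [in X in X -> _]inE [in X in X -> _]inE negbK => h; rewrite inE h /= eqxx.
  by move: (gh' l.1); lia.
have key : #|[set pi | respects g pi]| * #|F| <= #|[set pi | respects g' pi]|.
  rewrite -cardsX -(card_in_imset (f := switch l)).
    apply/subset_leq_card/subsetP => pi' /imsetP[[pi p]].
    move=> + ->; rewrite !inE /= => /andP[/respectsP r pF].
    apply/respectsP => l1 l2 /[dup] e' /g'g [l1l e].
    have l1g : l1 \in linked g by rewrite inE e.
    have l2l : l2.1 != l.1.
      apply/eqP => h; move: (gd _ _ e); rewrite h => h1.
      by move: (lmax _ l1g); rewrite /= leqNgt h1.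
    rewrite (seat_switch_other _ l2l) -(r _ _ e).
    have [h|h] := eqVneq l1.1 l.1; last by rewrite seat_switch_other.
    rewrite [l1]surjective_pairing h seat_switch_same /= tpermD //.
      by apply: contraNneq l1l => h2; rewrite [l1]surjective_pairing h -h2 -surjective_pairing.
    by apply: contraTneq pF => ->; rewrite -h -surjective_pairing e'.
  move=> [pi1 p1] [pi2 p2]; rewrite !inE /=.
  move=> /andP[/respectsP r1 pF1] /andP[/respectsP r2 pF2] e.
  have : g l != None by move: lg; rewrite inE.
  case gl : (g l) => [l'|//] _.
  have l'l : l'.1 != l.1 by apply/eqP => h; move: (gd _ _ gl); rewrite h ltnn.
  have s1 : seat (switch l (pi1, p1)) (l.1, p1) = seat (switch l (pi1, p1)) l'.
    rewrite seat_switch_same tpermR seat_switch_other //= -surjective_pairing; exact: r1.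
  have s2 : seat (switch l (pi2, p2)) (l.1, p2) = seat (switch l (pi2, p2)) l'.
    rewrite seat_switch_same tpermR seat_switch_other //= -surjective_pairing; exact: r2.
  have p12 : p1 = p2 by move: s1; rewrite e -s2 => /perm_inj.
  subst p2; congr pair; apply/ffunP => j.
  move/ffunP/(_ j): e; rewrite !ffunE /=; case: eqP => // _ /mulgI //.
rewrite !expnS mulnCA mulnA [X in _ <= X]mulnCA.
apply: leq_trans (leq_mul (leqnn 2) IH); rewrite mulnA leq_mul2r; apply/orP; right.
by move: key Fm; nia.
Qed.

Lemma leq_card_bigcup (I T : finType) (P : pred I) (F : I -> {set T}) :
  #|\bigcup_(i | P i) F i| <= \sum_(i | P i) #|F i|.
Proof.
elim/big_ind2: _ => [|A a B b hA hB|//]; first by rewrite cards0.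
by apply: leq_trans (leq_add hA hB); rewrite -cardsUI leq_addr.
Qed.

Definition repeat_links H (A : {set letter}) d : {set links} :=
  [set g | [&& linked g \subset [set l in A | l.1 \notin H], #|linked g| == d &
    [forall l, if g l is Some l' then (l' \in A) && (rk H l'.1 < rk H l.1) else true]]].

Lemma card_repeat_links H (A : {set letter}) d : #|repeat_links H A d| <= 2 ^ #|A| * #|A| ^ d.
Proof.
pose F (B : {set letter}) := [set g : links |
  g \in pffun_on None (mem B) (mem [set Some l | l in A])].
apply: (@leq_trans #|\bigcup_(B in powerset A | #|B| == d) F B|).
  apply/subset_leq_card/subsetP => g; rewrite inE => /and3P[/subsetP gA gd /forallP gr].
  apply/bigcupP; exists (linked g).
    by rewrite gd inE andbT; apply/subsetP => l /gA; rewrite inE => /andP[].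
  rewrite inE; apply/pffun_onP; split.
    by apply/subsetP => l; rewrite !inE.
  move=> o /imageP[l lg ->]; have := gr l; have : l \in linked g by [].
  rewrite inE; case: (g l) => // l' _ /andP[l'A _].
  exact: imset_f.
apply: leq_trans (leq_card_bigcup _ _) _.
rewrite -card_powerset -sum_nat_const big_mkcondr /=.
apply: leq_sum => B _; case: eqP => // Bd.
rewrite cardsE card_pffun_on Bd.
by rewrite leq_eqVlt; apply/orP; left; apply/eqP; congr (_ ^ _); rewrite (card_imset _ Some_inj).
Qed.

Definition link_union (g g1 : links) : links :=
  [ffun l => if g l is Some l' then Some l' else g1 l].

Lemma linked_union g g1 : linked (link_union g g1) = linked g :|: linked g1.
Proof. by apply/setP => l; rewrite !inE ffunE; case: (g l). Qed.

Lemma link_unionP g g1 l l' :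
  link_union g g1 l = Some l' -> g l = Some l' \/ g1 l = Some l'.
Proof. by rewrite ffunE; case e: (g l) => [l2|] <-; [left|right]. Qed.

Lemma repeat_links_exists pi H (A : {set letter}) d :
  d <= #|repeated pi H A| -> exists2 g, g \in repeat_links H A d & respects g pi.
Proof.
move=> /card_geqP[s [us sd sr]].
pose P l l' := (l' \in A) && ((rk H l'.1 < rk H l.1) && (seat pi l' == seat pi l)).
have sP l : l \in s -> exists l', P l l'.
  by move=> /sr; rewrite inE => /andP[_ /existsP].
pose g : links := [ffun l => if l \in s then [pick l' | P l l'] else None].
have gP l l' : g l = Some l' -> l \in s /\ P l l'.
  by rewrite ffunE; case: ifP => // _; case: pickP => // x Px [<-].
have lg : linked g = [set:: s].
  apply/setP => l; rewrite !inE ffunE; case: ifP => // /sP[l' Pl'].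
  by case: pickP => // /(_ l'); rewrite Pl'.
exists g; last first.
  by apply/respectsP => l l' /gP[_ /and3P[_ _ /eqP]].
rewrite inE lg; apply/and3P; split.
- apply/subsetP => l; rewrite [_ \in [set:: _]]inE => ls; have [l' /and3P[_ h _]] := sP _ ls.
  by have := sr _ ls; rewrite !inE -rk_gt0 => /andP[-> _]; rewrite (leq_ltn_trans _ h).
- by rewrite cardsE -sd; apply/eqP/card_uniqP.
- by apply/forallP => l; case e: (g l) => [l'|//]; case/gP: e => _ /and3P[-> ->].
Qed.

(** Light letters of different windows differ, so links chosen in all windows add up to d * W links,
    and a light player owns at most m/2 of them. *)
Lemma card_repeated_windows W (A : 'I_W -> {set letter}) H N d :
  (forall w, #|A w| <= N) ->
  (forall w w' l, w != w' -> l \in A w -> l \in A w' -> l.1 \in H) ->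
  (forall j, j \notin H -> (\sum_w #|[set l in A w | l.1 == j]|).*2 <= m) ->
  #|[set pi | [forall w, d <= #|repeated pi H (A w)|]]| * m ^ (d * W) <=
    m`! ^ n * (2 ^ N * N ^ d * 2 ^ d) ^ W.
Proof.
move=> AN Adisj Alight.
pose good k g := [set pi | respects g pi &&
  [forall w : 'I_W, (w < k) ==> (d <= #|repeated pi H (A w)|)]].
(* Here [g] collects the links of the later windows; the last hypothesis reserves room for the
   letters that each light player has in the first [k] windows. *)
have main k : k <= W -> forall g q, #|linked g| = q -> descending H g ->
    (forall (w : 'I_W) l, w < k -> l \in A w -> l \notin linked g) ->
    (forall j, j \notin H ->
       (#|[set l in linked g | l.1 == j]| +
        \sum_(w : 'I_W | w < k) #|[set l in A w | l.1 == j]|).*2 <= m) ->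
    #|good k g| * m ^ (q + d * k) <= m`! ^ n * (2 ^ q * (2 ^ N * N ^ d * 2 ^ d) ^ k).
  elim: k => [|k IH] kW g q gq gd gA gl.
    rewrite muln0 addn0 expn0 muln1.
    apply: leq_trans (card_respects gq gd _).
      by rewrite leq_mul2r; apply/orP; right; apply/subset_leq_card/subsetP => pi;
        rewrite !inE => /andP[].
    (* A heavy player has rank 0, hence owns no link. *)
    move=> j; have [jH|jH] := boolP (j \in H).
      rewrite (_ : [set _ in _ | _] = set0) ?cards0 //.
      apply/setP => l; rewrite !inE; case e: (g l) => [l'|//] /=.
      by apply/negP => /eqP h; move: (gd _ _ e); rewrite h {2}/rk jH.
    by apply: leq_trans (gl j jH); rewrite leq_double leq_addr.
  pose w0 := Ordinal kW.
  have sub : good k.+1 g \subset \bigcup_(g1 in repeat_links H (A w0) d) good k (link_union g g1).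
    apply/subsetP => pi; rewrite inE => /andP[/respectsP r /forallP h].
    have := h w0; rewrite ltnSn /= => /repeat_links_exists[g1 g1r /respectsP r1].
    apply/bigcupP; exists g1 => //; rewrite inE; apply/andP; split.
      by apply/respectsP => l l' /link_unionP[/r|/r1].
    by apply/forallP => w; apply/implyP => wk; have := h w; rewrite ltnS (ltnW wk).
  apply: leq_trans (leq_mul (subset_leq_card sub) (leqnn _)) _.
  apply: leq_trans (leq_mul (leq_card_bigcup _ _) (leqnn _)) _.
  have step g1 : g1 \in repeat_links H (A w0) d ->
     #|good k (link_union g g1)| * m ^ (q + d * k.+1) <=
     m`! ^ n * (2 ^ (q + d) * (2 ^ N * N ^ d * 2 ^ d) ^ k).
    rewrite inE => /and3P[/subsetP s1 /eqP c1 /forallP r1].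
    have s1A l : l \in linked g1 -> l \in A w0 /\ l.1 \notin H.
      by move/s1; rewrite inE => /andP[].
    have dis : [disjoint linked g & linked g1].
      rewrite disjoint_sym; apply/pred0P => l /=; apply/negP => /andP[/s1A[l0 _]].
      by apply/negP/(gA w0).
    rewrite mulnS addnA; apply: IH => //.
    - exact: ltnW.
    - by rewrite linked_union cardsU (eqP (_ : linked g :&: linked g1 == set0))
        ?setI_eq0 // cards0 gq c1 subn0.
    - move=> l l' /link_unionP[/gd//|e]; have := r1 l; rewrite e; by case/andP.
    - move=> w l wk lA; rewrite linked_union inE negb_or (gA w) // 1?ltnW //=.
      apply/negP => /s1A[l0 /negP]; apply; apply: (Adisj w w0) => //.
      by apply: contraTneq wk => ->; rewrite ltnn.
    - move=> j jH; apply: leq_trans (gl j jH); rewrite leq_double.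
      rewrite [X in _ <= _ + X](bigD1 w0) //= addnA; apply: leq_add.
        rewrite linked_union.
        apply: leq_trans
          (_ : #|[set l in linked g | l.1 == j] :|: [set l in A w0 | l.1 == j]| <= _).
          apply/subset_leq_card/subsetP => l; rewrite !in_setU !inE.
          move=> /andP[/orP[->|h] ->] //=; apply/orP; right; rewrite andbT.
          by case: (s1A l); rewrite ?inE.
        by rewrite -cardsUI leq_addr.
      rewrite leq_eqVlt; apply/orP; left; apply/eqP/eq_bigl => w.
      by rewrite ltnS andbC -val_eqE /= -ltn_neqAle.
  rewrite big_distrl /=;
  apply: (@leq_trans (\sum_(g1 in repeat_links H (A w0) d)
    (m`! ^ n * (2 ^ (q + d) * (2 ^ N * N ^ d * 2 ^ d) ^ k)))); first exact: leq_sum.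
  rewrite sum_nat_const.
  have cr : #|repeat_links H (A w0) d| <= 2 ^ N * N ^ d.
    apply: leq_trans (card_repeat_links _ _ _) _; apply: leq_mul; first by rewrite leq_exp2l.
    by case: (d) => // d'; rewrite leq_exp2r.
  apply: leq_trans (leq_mul cr (leqnn _)) _.
  by rewrite expnS expnD; set a := m`! ^ n; set b := _ ^ k;
    rewrite leq_eqVlt; apply/orP; left; apply/eqP; nia.
pose g0 : links := [ffun=> None].
have g00 : linked g0 = set0 by apply/setP => l; rewrite !inE ffunE.
have := main W (leqnn W) g0 0; rewrite g00 cards0 expn0 mul1n add0n => /(_ erefl) /= h.
apply: leq_trans (h _ _ _).
- rewrite leq_mul2r; apply/orP; right; apply/subset_leq_card/subsetP => pi.
  rewrite !inE => /forallP r; apply/andP; split; last by apply/forallP => w; rewrite r implybT.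
  by apply/respectsP => l l'; rewrite ffunE.
- by move=> l l'; rewrite ffunE.
- by move=> w l _ _; rewrite inE.
- move=> j jH; apply: leq_trans (Alight j jH); rewrite leq_double.
  rewrite (_ : [set _ in _ | _] = set0) ?cards0 ?add0n; last by apply/setP => l; rewrite !inE.
  by rewrite leq_eqVlt; apply/orP; left; apply/eqP/eq_bigl => w; rewrite ltn_ord.
Qed.
End Counting.

(** * The two kinds of bad families and their union bounds *)

Section Stretches.
Variables n m : nat.

Notation letter := ('I_n * 'I_m)%type.
Notation perms := {ffun 'I_n -> {perm 'I_m}}.
Implicit Types (P x : 'I_n -> nat) (pi : perms).

(** As a set of letters it ignores completed laps, so letting [i] stay below m loses nothing. *)
Definition stretch P x : {set letter} :=
  [set l : letter | [exists i : 'I_m, (i < x l.1) && (l.2 == (P l.1 + i) %% m :> nat)]].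

Lemma mem_stretch P x (l : letter) i :
  i < x l.1 -> i < m -> l.2 = (P l.1 + i) %% m :> nat -> l \in stretch P x.
Proof.
by move=> ix im e; rewrite inE; apply/existsP; exists (Ordinal im); rewrite ix e eqxx.
Qed.

Lemma stretchP P x (l : letter) :
  l \in stretch P x -> exists2 i, i < x l.1 & l.2 = (P l.1 + i) %% m :> nat.
Proof. by rewrite inE => /existsP[i /andP[ix /eqP e]]; exists i. Qed.

Lemma card_ltn_ord k : #|[set i : 'I_m | i < k]| <= k.
Proof.
rewrite cardsE cardE -(size_map val) -[k in _ <= k](size_iota 0).
apply: uniq_leq_size; first by rewrite map_inj_uniq ?enum_uniq //; exact: val_inj.
by move=> _ /mapP[i + ->]; rewrite mem_enum mem_iota.
Qed.

Lemma card_stretch_fiber P x j : #|[set l in stretch P x | l.1 == j]| <= x j.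
Proof.
case: (posnP m) => [m0|m0].
  by rewrite (leq_trans (max_card _)) // card_prod !card_ord m0 muln0.
pose f (i : 'I_m) : letter := (j, Ordinal (ltn_pmod (P j + i) m0)).
apply: leq_trans (card_ltn_ord (x j)).
apply: leq_trans (leq_imset_card f _); apply/subset_leq_card/subsetP => -[j' p].
rewrite inE => /andP[+ /= /eqP e]; rewrite {j'}e inE => /existsP[i /andP[/= ix /eqP ip]].
by apply/imsetP; exists i; rewrite ?inE //; congr pair; apply: val_inj.
Qed.

Lemma card_fibers (A : {set letter}) : #|A| = \sum_j #|[set l in A | l.1 == j]|.
Proof.
rewrite -sum1_card (partition_big (fun l : letter => l.1) predT) //=.
by apply: eq_bigr => j _; rewrite -sum1_card; apply: eq_bigl => l; rewrite !inE.
Qed.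

Lemma card_stretch_le P x : #|stretch P x| <= \sum_j x j.
Proof. by rewrite card_fibers; apply: leq_sum => j _; exact: card_stretch_fiber. Qed.

Lemma leq_card_bigcup_mul (I T : finType) (S : {set I}) (F : I -> {set T}) M B :
  (forall i, i \in S -> #|F i| * M <= B) -> #|\bigcup_(i in S) F i| * M <= #|S| * B.
Proof.
move=> h; apply: leq_trans (leq_mul (leq_card_bigcup _ _) (leqnn _)) _.
by rewrite big_distrl /= -sum_nat_const; apply: leq_sum.
Qed.

Section Bad.
Variables W N d : nat.

Notation profile := (n.-tuple 'I_N.+1).
Implicit Type X : {ffun 'I_W -> profile}.

Definition elapsed X (w : 'I_W) j : nat := \sum_(v < W | v < w) tnth (X v) j.

Definition heavy X : {set 'I_n} := [set j | m < (\sum_w tnth (X w) j).*2].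

Definition window (s : {ffun 'I_n -> 'I_m}) X w : {set letter} :=
  stretch (fun j => s j + elapsed X w j) (fun j => tnth (X w) j).

Definition bounded : {set profile} := [set x : profile | \sum_(i <- x) i <= N].

Definition long_bad : {set perms} :=
  \bigcup_(sX in setX [set: {ffun 'I_n -> 'I_m}] [set X | X \in ffun_on (mem bounded)])
    [set pi | [forall w, d <= #|repeated pi (heavy sX.2) (window sX.1 sX.2 w)|]].

(** A light player makes at most m/2 moves in all windows together, so it never completes a lap and
    its positions are distinct. *)
Lemma window_disjoint s X (w w' : 'I_W) (l : letter) :
  w != w' -> l \in window s X w -> l \in window s X w' -> l.1 \in heavy X.
Proof.
wlog ww' : w w' / w < w'.
  move=> h; case: (ltngtP w w') => [|lt ne a b|/val_inj -> /eqP//]; first exact: h.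
  by apply: h b a; rewrite // eq_sym.
move=> _ /stretchP[i ix e] /stretchP[i' i'x e']; rewrite inE ltnNge; apply/negP => le.
set j := l.1 in ix e i'x e' le.
have m0 : 0 < m by apply: leq_ltn_trans (ltn_ord l.2).
have h1 : elapsed X w j + tnth (X w) j <= elapsed X w' j.
  rewrite /elapsed [X in _ <= X](bigD1 w) //= addnC leq_add2l.
  rewrite big_mkcond [X in _ <= X]big_mkcond; apply: leq_sum => v _.
  case: ifP => // vw; rewrite (ltn_trans vw ww') /=.
  by case: eqVneq vw => // ->; rewrite ltnn.
have h2 : elapsed X w' j + tnth (X w') j <= \sum_v tnth (X v) j.
  rewrite /elapsed [X in _ <= X](bigD1 w') //= addnC leq_add2l.
  rewrite big_mkcond [X in _ <= X]big_mkcond; apply: leq_sum => v _.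
  by case: ifP => // vw; case: eqVneq vw => // ->; rewrite ltnn.
move: e'; rewrite e => /eqP; rewrite -!addnA eqn_modDl !modn_small; lia.
Qed.

Lemma card_bounded : #|bounded| = 'C(n + N, n).
Proof. exact: card_partial_ord_partitions. Qed.

Lemma boundedE (x : profile) : (x \in bounded) = (\sum_j tnth x j <= N).
Proof. by rewrite inE big_tuple. Qed.

Lemma card_long_bad :
  #|long_bad| * m ^ (d * W) <=
  m ^ n * 'C(n + N, n) ^ W * (m`! ^ n * (2 ^ N * N ^ d * 2 ^ d) ^ W).
Proof.
apply: leq_trans (leq_card_bigcup_mul (B := m`! ^ n * (2 ^ N * N ^ d * 2 ^ d) ^ W) _) _.
  move=> [s X]; rewrite inE /= inE => /andP[_]; rewrite inE => /ffun_onP XN.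
  apply: card_repeated_windows => [w|w w' l|j].
  - by apply: leq_trans (card_stretch_le _ _) _; rewrite -boundedE; exact: XN.
  - exact: window_disjoint.
  - rewrite inE -leqNgt; apply: leq_trans; rewrite leq_double; apply: leq_sum => w _.
    exact: card_stretch_fiber.
rewrite cardsX cardsT card_ffun !card_ord leq_mul2r; apply/orP; right.
by rewrite cardsE card_ffun_on card_ord -card_bounded.
Qed.

Definition few_letters (K : {set 'I_n}) (s : {ffun 'I_n -> 'I_m}) (x : profile) :=
  [set l in stretch (fun j => s j) (fun j => tnth x j) | l.1 \in K].

(* The default z pins down the positions of the players outside K, so that    *)
(* only m ^ #|K| starting positions have to be counted.                       *)
Definition short_bad (z : 'I_m) e : {set perms} :=
  \bigcup_(K in [set K : {set 'I_n} | #|K| <= e])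
  \bigcup_(sx in setX [set s | s \in pffun_on z (mem K) predT] bounded)
    [set pi | d <= #|repeated pi set0 (few_letters K sx.1 sx.2)|].

(** In a single window a player makes at most N <= m/2 moves, so nobody has to count as heavy and
    all coincidences can be charged. The price is 2^n choices of [K] and m^e of positions. *)
Lemma card_short_bad z e : N.*2 <= m ->
  #|short_bad z e| * m ^ d <=
  2 ^ n * (m ^ e * 'C(n + N, n) * (m`! ^ n * (2 ^ N * N ^ d * 2 ^ d))).
Proof.
move=> Nm; have m0 : 0 < m by apply: leq_ltn_trans (ltn_ord z).
set B := _ * _ * (_ * _).
apply: leq_trans (leq_card_bigcup_mul (B := B) _) _; last first.
  by rewrite leq_mul2r -[X in 2 ^ X](card_ord n) -cardsT -card_powerset powersetT
    cardsT max_card orbT.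
move=> K; rewrite inE => Ke.
apply: leq_trans (leq_card_bigcup_mul (B := m`! ^ n * (2 ^ N * N ^ d * 2 ^ d)) _) _; last first.
  rewrite cardsX card_bounded cardsE card_pffun_on card_ord /B leq_mul2r leq_mul2r.
  by rewrite leq_pexp2l ?orbT.
move=> [s x] /setXP[_ xN].
have sub : few_letters K s x \subset stretch (fun j => s j) (fun j => tnth x j).
  by apply/subsetP => l; rewrite inE => /andP[].
have := @card_repeated_windows n m 1 (fun=> few_letters K s x) set0 N d.
rewrite muln1 expn1 => h; apply: leq_trans (h _ _ _).
- rewrite leq_mul2r; apply/orP; right; apply/subset_leq_card/subsetP => pi.
  by rewrite !inE => h'; apply/forallP.
- move=> _; apply: leq_trans (subset_leq_card sub) _.
  by apply: leq_trans (card_stretch_le _ _) _; rewrite -boundedE.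
- by move=> w w'; rewrite !ord1.
- move=> j _; rewrite big_ord1; apply: leq_trans Nm; rewrite leq_double.
  apply: (@leq_trans (tnth x j)); last by rewrite -ltnS.
  apply: leq_trans (card_stretch_fiber (fun j => s j) (fun j => tnth x j) j).
  apply/subset_leq_card/subsetP => l.
  by rewrite !inE => /andP[/andP[-> _] ->].
Qed.
End Bad.
End Stretches.

(** * Choice of the constants and existence of a good family *)

Lemma bin_le_exp2 k j : 'C(k, j) <= 2 ^ k.
Proof.
rewrite -[k in 'C(k, _)](card_ord k) -card_draws -[X in 2 ^ X](card_ord k).
by rewrite -cardsT -card_powerset powersetT cardsT max_card.
Qed.

Lemma quadratic_le_exp2 k : 24 <= k -> 14 * (k.+1 * k.+2) <= 2 ^ k.
Proof.
elim: k => // k IH; rewrite leq_eqVlt => /orP[/eqP <- //|k24].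
by have := IH k24; rewrite expnS; nia.
Qed.

(** About log m windows, so that their joint gain outweighs the m^n starting positions. *)
Definition rounds m := (trunc_log 2 m).+2.

(* As rounds windows have at most 7 n moves each, at most                     *)
(* 14 n (rounds m) / m players make more than m / 2 moves.                    *)
Lemma good_family_exists n m (z : 'I_m) : 0 < n -> 2 ^ 24 * n <= m ->
  exists2 pi, pi \notin long_bad n m (rounds m) (7 * n) n &
    pi \notin short_bad n (7 * n) n z ((14 * n * rounds m) %/ m).
Proof.
move=> n0 mn; set W := rounds m; set e := _ %/ m.
set k := trunc_log 2 m.
have m0 : 0 < m by apply: leq_trans mn; rewrite muln_gt0 n0 andbT expn_gt0.
have mk : m < 2 ^ k.+1 by exact: trunc_log_ltn.
have km : 2 ^ k <= m by exact: trunc_logP.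
have k24 : 24 <= k.
  apply: trunc_log_max => //; apply: leq_trans mn; exact: leq_pmulr.
(* With e <= 14 n (k + 2) / m this reduces to 14 (k + 1) (k + 2) <= 2^k <= m. *)
have me : m ^ e <= 2 ^ n.
  apply: (@leq_trans (2 ^ (k.+1 * e))).
    by rewrite expnM; case: (e) => // e'; rewrite leq_exp2r // ltnW.
  rewrite leq_exp2l // -(leq_pmul2r m0).
  have := leq_trunc_div (14 * n * W) m; rewrite -/e => h.
  have := quadratic_le_exp2 k24; rewrite /W /rounds -/k in h * => q.
  by rewrite -mulnA; apply: leq_trans (leq_mul (leqnn _) h) _; nia.
set F := #|{: {ffun 'I_n -> {perm 'I_m}}}|.
have FE : m`! ^ n = F by rewrite /F card_ffun card_ord card_Sn.
set N := 7 * n; set a := 'C(n + N, n) * (2 ^ N * N ^ n * 2 ^ n).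
have a0 : 0 < a.
  by rewrite !muln_gt0 bin_gt0 leq_addr !expn_gt0 /= /N muln_gt0 n0.
(* Here 24 = 8 + 7 + 3 + 1 + 5: the binomial is at most 2^(8n), 2^N is 2^(7n), 7^n is at most
   2^(3n), then comes 2^n, and a gain of 2^(5n) per window remains. *)
have am : 2 ^ (5 * n) * a <= m ^ n.
  apply: (@leq_trans ((2 ^ 24 * n) ^ n)); last by rewrite leq_exp2r.
  have N8 : N ^ n <= 2 ^ (3 * n) * n ^ n.
    by rewrite expnM -expnMn leq_exp2r // leq_mul2r orbT.
  have c8 : 'C(n + N, n) <= 2 ^ (8 * n) by rewrite (_ : 8 * n = n + N) ?bin_le_exp2 // /N; lia.
  rewrite expnMn -expnM /a.
  apply: leq_trans (leq_mul (leqnn _) (leq_mul c8 (leq_mul (leq_mul (leqnn _) N8) (leqnn _)))) _.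
  rewrite (_ : 24 * n = 5 * n + (8 * n + (N + 3 * n + n))); last by rewrite /N; lia.
  move: (5 * n) (8 * n) (3 * n) (N) => b5 b8 b3 b; rewrite !expnD -!mulnA.
  by rewrite [n ^ n * _]mulnC.
have longF : #|long_bad n m W N n| * 4 <= F.
  have := card_long_bad n m W N n; rewrite FE mulnACA -mulnA -expnMn -/a => h.
  have pos : 0 < m ^ n * a ^ W.
    by rewrite muln_gt0 [0 < m ^ n]expn_gt0 [0 < a ^ W]expn_gt0 m0 a0.
  rewrite -(leq_pmul2r pos).
  apply: leq_trans (_ : F * (m ^ n * a ^ W) <= _) => //.
  apply: leq_trans (leq_trans h _); last by rewrite mulnCA.
  rewrite -mulnA leq_mul2l; apply/orP; right.
  rewrite expnM; apply: (@leq_trans ((2 ^ (5 * n) * a) ^ W)); last by rewrite leq_exp2r.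
  rewrite expnMn mulnA leq_mul2r; apply/orP; right.
  (* The gain of all windows pays for the factor 4 and for m^n <= 2^(n (k + 1)). *)
  rewrite -expnM (_ : 5 * n * W = 2 + (n * k.+1 + (4 * n * W + n - 2))); last first.
    rewrite /W /rounds -/k; nia.
  rewrite expnD leq_mul2l /= expnD -[X in X <= _]muln1 leq_mul ?expn_gt0 //.
  by rewrite mulnC expnM leq_exp2r // ltnW.
have shortF : #|short_bad n N n z e| * 4 <= F.
  have N2 : N.*2 <= m by apply: leq_trans mn; rewrite /N; lia.
  have := @card_short_bad n m N n z e N2; rewrite FE => h.
  have pos : 0 < 2 ^ (2 * n) * a by rewrite muln_gt0 [0 < 2 ^ _]expn_gt0 a0.
  rewrite -(leq_pmul2r pos).
  apply: (@leq_trans (#|short_bad n N n z e| * m ^ n)).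
    rewrite -mulnA leq_mul2l; apply/orP; right; apply: leq_trans am.
    rewrite mulnA leq_mul2r; apply/orP; right.
    by rewrite -[4]/(2 ^ 2) -expnD leq_exp2l //; lia.
  apply: leq_trans h _.
  rewrite (_ : _ * _ = 2 ^ n * m ^ e * (F * a)); last first.
    by rewrite /a; set u := 'C(_, _); set v := 2 ^ N * _ * _; nia.
  rewrite [X in _ <= X]mulnCA leq_mul2r mul2n -addnn expnD.
  by rewrite [_ * m ^ e <= _]leq_mul ?orbT.
have F0 : 0 < F by rewrite -FE expn_gt0 fact_gt0.
(* Each kind of bad family takes up at most a quarter of all families. *)
have /set0Pn[pi] : ~: (long_bad n m W N n :|: short_bad n N n z e) != set0.
  rewrite -card_gt0; have := cardsC (long_bad n m W N n :|: short_bad n N n z e).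
  have := cardsUI (long_bad n m W N n) (short_bad n N n z e).
  rewrite -/F; lia.
by rewrite in_setC in_setU negb_or => /andP[]; exists pi.
Qed.

(** * An endless play forces a bad family *)

Lemma eq_stretch n m (P P' x x' : 'I_n -> nat) :
  (forall j, P j = P' j %[mod m]) -> x =1 x' -> stretch m P x = stretch m P' x'.
Proof.
move=> eP ex; apply/setP => l; rewrite !inE; apply: eq_existsb => i.
by rewrite ex -modnDml eP modnDml.
Qed.

Lemma card_stretch n m (P x : 'I_n -> nat) :
  (forall j, x j <= m) -> #|stretch m P x| = \sum_j x j.
Proof.
move=> xm; apply/eqP; rewrite eqn_leq card_stretch_le /= card_fibers; apply: leq_sum => j _.
case: (posnP m) => [m0|m0]; first by move: (xm j); rewrite m0 leqn0 => /eqP ->.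
pose f (i : 'I_(x j)) : 'I_n * 'I_m := (j, Ordinal (ltn_pmod (P j + i) m0)).
have fI : injective f.
  move=> i i' [/eqP]; rewrite eqn_modDl !modn_small ?(leq_trans (ltn_ord _) (xm j)) //.
  by move=> /eqP/val_inj.
rewrite -[x j in X in X <= _]card_ord -cardsT -(card_imset _ fI).
apply/subset_leq_card/subsetP => l /imsetP[i _ ->]; rewrite inE eqxx andbT.
by apply: (mem_stretch (i := i)) => //=; apply: leq_trans (xm j).
Qed.

Section Run.
Variables (n m : nat) (pi : {ffun 'I_n -> {perm 'I_m}}).
Variables (q : nat -> 'I_n -> 'I_m) (S : nat -> {set 'I_n}).
Hypothesis qS : forall t j, q t.+1 j = (if j \in S t then (q t j).+1 %% m else q t j) :> nat.
Hypothesis S_neq0 : forall t, S t != set0.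
Hypothesis S_conflict : forall t j, j \in S t ->
  exists2 j', j' != j & pi j' (q t j') = pi j (q t j).

Notation letter := ('I_n * 'I_m)%type.

Definition moves t j : nat := \sum_(u < t) (j \in S u).

Lemma movesS t j : moves t.+1 j = moves t j + (j \in S t).
Proof. by rewrite /moves big_ord_recr. Qed.

Lemma moves_le t t' j : t <= t' -> moves t j <= moves t' j.
Proof.
move=> /subnK <-; elim: (t' - t) => // k IH.
by rewrite addSn movesS (leq_trans IH) // leq_addr.
Qed.

Lemma positionE t t' j : t <= t' ->
  q t' j = (q t j + (moves t' j - moves t j)) %% m :> nat.
Proof.
move=> /subnK <-; elim: (t' - t) => [|k IH].
  by rewrite subnn addn0 modn_small.
rewrite addSn qS movesS -addnBAC ?moves_le ?leq_addl //.
case: (j \in S _); last by rewrite addn0.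
by rewrite IH -[_.+1]addn1 modnDml addnA.
Qed.

Definition total t : nat := \sum_j moves t j.

Lemma totalS t : total t.+1 = total t + #|S t|.
Proof.
rewrite /total -sum1_card [X in _ = _ + X]big_mkcond -big_split /=.
by apply: eq_bigr => j _; rewrite movesS; case: (j \in S t).
Qed.

Lemma total_le t t' : t <= t' -> total t <= total t'.
Proof. by move=> tt'; apply: leq_sum => j _; exact: moves_le. Qed.

(** A round has between 1 and n movers, so the total passes every [y] and overshoots it by at most
    n. *)
Lemma total_reach y : exists t, y <= total t <= y + n.
Proof.
elim: y => [|y [t /andP[yt ty]]].
  by exists 0; rewrite /total big1 // => j _; rewrite /moves big_ord0.
case: (ltngtP y (total t)) yt => // [yt _|-> _]; first by exists t; rewrite yt ltnW.
exists t.+1; rewrite totalS.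
have : #|S t| <= n by rewrite -[X in _ <= X](card_ord n) max_card.
by have := S_neq0 t; rewrite -card_gt0; lia.
Qed.

Definition departed t0 t1 : {set letter} :=
  [set l | [exists u : 'I_t1, [&& t0 <= u, l.1 \in S u & q u l.1 == l.2]]].

Lemma departedP t0 t1 l : reflect
  (exists u, [/\ t0 <= u, u < t1, l.1 \in S u & q u l.1 = l.2]) (l \in departed t0 t1).
Proof.
rewrite inE; apply: (iffP existsP) => [[u /and3P[a b /eqP c]]|[u [a b c d]]].
  by exists u; split.
by exists (Ordinal b); rewrite /= a c d eqxx.
Qed.

(** The count grows by at most one per round, so it cannot skip [k]. *)
Lemma moves_attained t0 t1 j k : moves t0 j <= k < moves t1 j ->
  exists u, [/\ t0 <= u, u < t1, j \in S u & moves u j = k].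
Proof.
elim: t1 => [|t1 IH] /andP[k0 k1]; first by rewrite /moves big_ord0 in k1.
have [k2|k2] := ltnP k (moves t1 j).
  by case: IH => [|u [a b c d]]; [rewrite k0 | exists u; split=> //; exact: ltnW].
move: k1; rewrite movesS; case jS : (j \in S t1); last by rewrite addn0 ltnNge k2.
rewrite addn1 ltnS => k1; have e : moves t1 j = k by apply/eqP; rewrite eqn_leq k2 k1.
exists t1; split=> //; rewrite leqNgt; apply/negP => /(moves_le j).
by rewrite movesS jS e addn1 ltnNge k0.
Qed.

Lemma departed_stretch t0 t1 : (forall j, moves t1 j - moves t0 j <= m) ->
  departed t0 t1 = stretch m (fun j => q t0 j) (fun j => moves t1 j - moves t0 j).
Proof.
move=> xm; apply/setP => l; apply/departedP/idP => [[u [a b c d]]|/stretchP[i ix e]].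
  have h : moves u.+1 l.1 <= moves t1 l.1 by exact: moves_le.
  move: h (moves_le l.1 a) (xm l.1); rewrite movesS c addn1 => h1 h2 h3.
  have h4 : moves u l.1 - moves t0 l.1 < moves t1 l.1 - moves t0 l.1.
    by rewrite ltn_sub2r // (leq_ltn_trans h2).
  by apply: mem_stretch h4 (leq_trans h4 h3) _; rewrite -positionE ?d.
have [|u [a b c d]] := @moves_attained t0 t1 l.1 (moves t0 l.1 + i).
  by rewrite leq_addr -ltn_subRL.
by exists u; split=> //; apply: val_inj; rewrite [RHS]e /= (positionE _ a) d addKn.
Qed.

Lemma departs_or_stays t j t1 : t <= t1 ->
  (exists u, [/\ t <= u, u < t1, j \in S u & q u j = q t j]) \/ q t1 j = q t j.
Proof.
move=> /subnK <-; elim: (t1 - t) => [|k IH]; first by right.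
case: IH => [[u [a b c d]]|e]; first by left; exists u; split=> //; rewrite addSn ltnS ltnW.
case jS : (j \in S (k + t)).
  by left; exists (k + t); split; rewrite // ?leq_addl ?addSn.
by right; apply: val_inj; rewrite addSn /= qS jS e.
Qed.

(* Every departure meets another player, who either departs from the same    *)
(* chair within the window or still sits there at its end; at most n chairs  *)
(* are of the second kind.                                                   *)
Lemma card_departed_seats t0 t1 :
  #|seat pi @: departed t0 t1|.*2 <= #|departed t0 t1| + n.
Proof.
set D := departed t0 t1; set E := [set pi j (q t1 j) | j : 'I_n].
have En : #|E| <= n by rewrite -[X in _ <= X](card_ord n) leq_imset_card.
apply: leq_trans (leq_add (leqnn _) En).
have fibers : #|D| = \sum_(a in seat pi @: D) #|[set l in D | seat pi l == a]|.
  rewrite -sum1_card (partition_big (seat pi) (mem (seat pi @: D))) /=; last exact: imset_f.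
  by apply: eq_bigr => a _; rewrite -sum1_card; apply: eq_bigl => l; rewrite !inE.
have ED : \sum_(a in seat pi @: D) (a \in E) <= #|E|.
  rewrite -sum1_card big_mkcond [X in _ <= X]big_mkcond; apply: leq_sum => a _.
  by case: (a \in E); case: ifP.
(* Each chair departed from contributes at least 2: besides [l] there is another departed letter on
   it, or the chair lies in [E]. *)
rewrite fibers; apply: leq_trans (leq_add (leqnn _) ED); rewrite -big_split /=.
rewrite -mul2n mulnC -sum_nat_const; apply: leq_sum => _ /imsetP[l lD ->].
have lf : l \in [set l' in D | seat pi l' == seat pi l] by rewrite inE lD eqxx.
have [u [tu ut lS lq]] := departedP _ _ _ lD.
have [j' j'l e] := S_conflict lS; rewrite lq in e.
case: (departs_or_stays j' (ltnW ut)) => [[v [uv vt jS jq]]|jq].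
  rewrite (cardsD1 l) lf -addnA ltnS addn_gt0 card_gt0; apply/orP; left.
  apply/set0Pn; exists (j', q u j'); rewrite in_setD1 inE; apply/and3P; split.
  - by apply: contra j'l => /eqP <-.
  - by apply/departedP; exists v; split=> //; exact: leq_trans uv.
  - by rewrite /seat /= e.
have -> : seat pi l \in E by apply/imsetP; exists j' => //; rewrite jq.
by rewrite addn1 ltnS card_gt0; apply/set0Pn; exists l.
Qed.

Lemma run_is_bad W (z : 'I_m) : 0 < n -> 14 * n <= m ->
  pi \in long_bad n m W (7 * n) n \/ pi \in short_bad n (7 * n) n z ((14 * n * W) %/ m).
Proof.
move=> n0 nm; set N := 7 * n.
(* Targets 6n apart, each overshot by at most n, give windows of between 5n and 7n moves. As [tau 0]
   need not be 0, positions and counts are taken relative to it. *)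
pose tau w := xchoose (total_reach (6 * n * w)).
have tauP w : 6 * n * w <= total (tau w) <= 6 * n * w + n := xchooseP (total_reach _).
have tau_lt w : tau w <= tau w.+1.
  rewrite leqNgt; apply/negP => /ltnW/total_le; have := tauP w; have := tauP w.+1.
  rewrite mulnS; lia.
pose x w j := moves (tau w.+1) j - moves (tau w) j.
have xsum w : 5 * n <= \sum_j x w j <= N.
  have -> : \sum_j x w j = total (tau w.+1) - total (tau w).
    by rewrite sumnB // => j _; exact: moves_le.
  have := tauP w; have := tauP w.+1; rewrite mulnS /N; lia.
have xN w j : x w j <= N.
  have /andP[_] := xsum w; apply: leq_trans.
  by rewrite (bigD1 j) //= leq_addr.
have xm w j : x w j <= m by apply: leq_trans (xN w j) _; rewrite /N; lia.
pose X : {ffun 'I_W -> n.-tuple 'I_N.+1} := [ffun w : 'I_W => [tuple inord (x w j) | j < n]].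
have XE w j : tnth (X w) j = x w j :> nat by rewrite ffunE tnth_mktuple inordK // ltnS.
have Xb w : X w \in bounded n N.
  by rewrite boundedE; have /andP[_] := xsum w; under eq_bigr do rewrite -XE.
pose s : {ffun 'I_n -> 'I_m} := [ffun j => q (tau 0) j].
have tau0 w : tau 0 <= tau w by elim: w => // w IH; exact: leq_trans (tau_lt w).
have elE w j : elapsed X w j = moves (tau w) j - moves (tau 0) j.
  rewrite /elapsed; under eq_bigr do rewrite XE.
  rewrite -(big_ord_widen W (fun v => x v j) (ltnW (ltn_ord w))).
  elim: (w : nat) => [|v IH]; first by rewrite big_ord0 subnn.
  rewrite big_ord_recr /= IH /x.
  have := moves_le j (tau_lt v); have := moves_le j (tau0 v); lia.
have winE w : window s X w = departed (tau w) (tau w.+1).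
  rewrite departed_stretch ?/window; last exact: xm.
  apply: eq_stretch => j; last exact: XE.
  by rewrite ffunE elE -positionE ?modn_small.
(* Either every window has n coincidences charged to light letters, or some window leaves the rest
   to the heavy players. *)
have [/forallP good|/forallPn[w]] :=
    boolP [forall w, n <= #|repeated pi (heavy m X) (window s X w)|].
  left; apply/bigcupP; exists (s, X); last by rewrite inE; apply/forallP.
  by rewrite inE /= in_setT inE; apply/ffun_onP.
rewrite -ltnNge => repn; right; set H := heavy m X in repn *.
apply/bigcupP; exists H.
  (* A heavy player makes more than m/2 of the at most 7nW moves. *)
  rewrite inE leq_divRL; last by apply: leq_ltn_trans (ltn_ord z).
  rewrite -sum_nat_const.
  apply: (@leq_trans (\sum_(j in H) (\sum_w tnth (X w) j).*2)).
    by apply: leq_sum => j; rewrite inE => /ltnW.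
  apply: (@leq_trans (\sum_j (\sum_w tnth (X w) j).*2)).
    by rewrite [X in _ <= X](bigID (mem H)) /= leq_addr.
  under eq_bigr do rewrite -mul2n.
  rewrite -big_distrr /= exchange_big /= (_ : 14 * n * W = 2 * (W * N)); last by rewrite /N; lia.
  rewrite leq_mul2l /= -[W in X in _ <= X]card_ord -sum_nat_const; apply: leq_sum => w' _.
  by rewrite -boundedE.
clearbody H; pose s' : {ffun 'I_n -> 'I_m} := [ffun j => if j \in H then q (tau w) j else z].
set A := window s X w in repn.
have few : few_letters H s' (X w) = [set l in A | l.1 \in H].
  rewrite /A winE departed_stretch; last exact: xm.
  apply/setP => l; rewrite !inE; apply: andb_id2r => lH; apply: eq_existsb => i.
  by rewrite XE ffunE lH.
apply/bigcupP; exists (s', X w).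
  rewrite inE /= Xb andbT inE; apply/pffun_onP; split=> //.
  by apply/subsetP => j; rewrite !inE ffunE; case: (j \in H); rewrite ?eqxx.
rewrite inE /= few; set B := [set l in A | _].
(* With T = #|A| >= 5n, [c3] gives T - #|seat pi @: A| >= (T - n)/2 >= 2n. By [c1] fewer than n of
   this loss is due to light letters, so by [c2] more than n coincidences lie among the heavy
   players. *)
have c1 := card_repeated pi H A; have c2 := card_repeated pi set0 B.
have c3 := card_departed_seats (tau w) (tau w.+1).
have c4 : #|A| = \sum_j x w j by rewrite /A winE departed_stretch ?card_stretch //; exact: xm.
have c5 : #|A| = #|B| + #|[set l in A | l.1 \notin H]|.
  rewrite -(cardsID [set l : letter | l.1 \in H] A).
  by congr (_ + _); apply: eq_card => l; rewrite !inE // andbC.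
have c6 : [set l in B | l.1 \notin set0] = B by apply/setP => l; rewrite !inE andbT.
rewrite c6 -winE -/A in c2 c3; have := xsum w; rewrite -c4; rewrite -/B in c1.
move: c1 c2 c3 c5 repn.
by move: #|seat pi @: A| #|seat pi @: B| #|repeated pi H A| #|repeated pi set0 B| => a b r r'; lia.
Qed.
End Run.

(** * From permutations to words, and the game itself *)

Definition perm_word m (p : {perm 'I_m}) : seq 'I_m := [seq p i | i <- enum 'I_m].

Lemma size_perm_word m (p : {perm 'I_m}) : size (perm_word p) = m.
Proof. by rewrite size_map size_enum_ord. Qed.

Lemma perm_wordP m (p : {perm 'I_m}) : is_perm_word (perm_word p).
Proof.
split=> [|a]; first exact: size_perm_word.
rewrite count_uniq_mem; last by rewrite map_inj_uniq ?enum_uniq //; exact: perm_inj.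
by rewrite -[a](permKV p) map_f ?mem_enum.
Qed.

(** A play that never ends is one fixed sequence of positions and movers. Dependence of the strategy
    on the past is harmless, as the bad sets range over starting positions and numbers of moves
    only. *)
Lemma good_family_wins n m (pi : {ffun 'I_n -> {perm 'I_m}}) (z : 'I_m) W :
  0 < n -> 14 * n <= m ->
  pi \notin long_bad n m W (7 * n) n ->
  pi \notin short_bad n (7 * n) n z ((14 * n * W) %/ m) ->
  oblivious_MC_algorithm (fun i => perm_word (pi i)).
Proof.
move=> n0 nm ok_long ok_short; set w := fun i => _.
split=> [i|start sigma leg].
  apply/eqP; rewrite -size_eq0 size_perm_word -lt0n; exact: leq_ltn_trans (ltn_ord z).
apply: boolp.contrapT => never.
pose c t := (play sigma start t).1; pose past t := (play sigma start t).2.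
have conflict t : in_conflict (c t) != set0.
  apply/eqP => none; apply: never; exists t => i j e; apply/eqP.
  have [//|ij] := eqVneq i j; move/setP/(_ i): none; rewrite !inE.
  by move/existsP; case; exists j; rewrite eq_sym ij /c e eqxx.
have cS t : c t.+1 = move (c t) (sigma (c t) (past t)).
  rewrite /c /past /=; move: (conflict t); rewrite /c.
  by case: (play sigma start t) => ct pt /= /negbTE ->.
pose q t i : 'I_m := cast_ord (size_perm_word (pi i)) (c t i).
have chairE t i : chair (c t) i = pi i (q t i).
  rewrite /chair (tnth_nth z) /= (nth_map z) ?size_enum_ord; last first.
    by rewrite -[m in _ < m](size_perm_word (pi i)).
  congr (pi i _); apply: val_inj; rewrite /= nth_enum_ord //.
  by rewrite -[m in _ < m](size_perm_word (pi i)).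
case: (@run_is_bad n m pi q (fun t => sigma (c t) (past t)) _ _ _ W z n0 nm) => [t j|t|t j jS||].
- rewrite /q cS /= ffunE; case: ifP => _ //=.
  by congr (_ %% _); exact: size_perm_word.
- by case: (leg _ (past t) (conflict t)).
- have [_ /subsetP/(_ j jS)] := leg _ (past t) (conflict t).
  by rewrite inE => /existsP[k /andP[kj /eqP e]]; exists k; rewrite // -!chairE.
- exact/negP.
- exact/negP.
Qed.

Import Order.TTheory GRing.Theory Num.Theory.
Local Open Scope ring_scope.

Theorem theorem7 (R : realType) :
  exists c : R, 0 < c /\
    forall n m : nat, c * n%:R <= m%:R ->
      exists w : 'I_n -> seq 'I_m,
        (forall i : 'I_n, is_perm_word (w i)) /\ oblivious_MC_algorithm w.
Proof.
exists (2 ^ 24)%N%:R; split=> [|n m]; first by rewrite ltr0n expn_gt0.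
rewrite -natrM ler_nat => mn; have [n0|n0] := posnP n.
  (* Without players m may be 0, and then there is no chair to serve as [z]. *)
  subst n; exists (fun=> [::]); split=> [[]//|]; split=> [[]//|start sigma _].
  by exists 0%N => -[].
have m0 : (0 < m)%N by apply: leq_trans mn; rewrite muln_gt0 n0 expn_gt0.
have [pi pi_long pi_short] := good_family_exists (Ordinal m0) n0 mn.
exists (fun i => perm_word (pi i)); split=> [i|]; first exact: perm_wordP.
apply: good_family_wins pi_long pi_short => //.
apply: leq_trans mn; rewrite leq_mul2r; apply/orP; right.
by apply: (@leq_trans (2 ^ 4)); rewrite ?leq_exp2l.
Qed.
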